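(* Let $n\geq 2$ be an integer and let $G$ be a finite, simple, connected graph with at least two vertices. If $G$ is of QE class, then the graphs $G\{K_n\}$ and $G\{K_{1,n-1}\}$ are of QE class, where $K_n$ is the complete graph on $n$ vertices and $K_{1,n-1}$ is the star graph on $n$ vertices rooted at its center.
   Context: All graphs are finite, simple, connected and unweighted. A graph $G=(V,E)$ with graph distance $d$ (length of a shortest path) is of QE class if it admits a quadratic embedding, i.e. a map $\psi:V\to\mathcal{H}$ into a Euclidean space $\mathcal{H}$ such that $d(i,j)=\|\psi(i)-\psi(j)\|^2$ for all $i,j\in V$. Given a graph $G_1$ with vertex set $V(G_1)$ and a rooted graph $G_2$, the cluster $G_1\{G_2\}$ is the graph obtained by taking one copy of $G_1$ and $|V(G_1)|$ disjoint copies of $G_2$, and identifying the root of the $i$-th copy of $G_2$ with the $i$-th vertex of $G_1$, for $i=1,\dots,|V(G_1)|$ (the same root vertex being used in every copy). For $K_n$ the choice of root is immaterial. For $K_{1,1}$, either vertex may be designated as the center. *)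

(* Defs.v *)
From mathcomp Require Import all_boot all_order all_algebra.
From mathcomp Require Import reals.

Set Implicit Arguments.
Unset Strict Implicit.
Unset Printing Implicit Defensive.

Import Order.TTheory GRing.Theory Num.Theory.

Structure cgraph := CGraph {
  vertex :> finType;
  adj : rel vertex;
  adj_sym : symmetric adj;
  adj_irr : irreflexive adj;
  adj_conn : forall x y, connect adj x y
}.
Arguments adj {c} : rename.

Definition path_of_length (G : cgraph) (x y : G) (k : nat) : bool :=
  [exists p : k.-tuple G,
    [&& path adj x p, uniq (x :: p) & last x p == y]].

Lemma exists_path_of_length (G : cgraph) (x y : G) :
  exists k, path_of_length x y k.
Proof.
have /connectP [p0 p0P ->] := adj_conn x y.
case/shortenP: p0P => p pP pU _.
exists (size p); apply/existsP; exists (in_tuple p).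
by rewrite pP pU eqxx.
Qed.

Definition gdist (G : cgraph) (x y : G) : nat :=
  ex_minn (exists_path_of_length x y).

Lemma homo_connect (T T' : finType) (e : rel T) (e' : rel T') (f : T -> T') :
  {homo f : x y / e x y >-> e' x y} ->
  {homo f : x y / connect e x y >-> connect e' x y}.
Proof.
move=> fP x y /connectP [p pP ->]; apply/connectP; exists (map f p).
  exact: homo_path pP.
by rewrite last_map.
Qed.

Section Complete.
Variable n : nat.

Definition complete_adj : rel 'I_n := fun i j => i != j.

Lemma complete_sym : symmetric complete_adj.
Proof. by move=> i j; rewrite /complete_adj eq_sym. Qed.

Lemma complete_irr : irreflexive complete_adj.
Proof. by move=> i; rewrite /complete_adj eqxx. Qed.

Lemma complete_conn (i j : 'I_n) : connect complete_adj i j.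
Proof.
have [->|ij] := eqVneq i j; first exact: connect0.
exact: connect1.
Qed.

Definition complete_graph := CGraph complete_sym complete_irr complete_conn.
End Complete.

(* K_{1,m}: [None] is one side of the bipartition, the [Some i] are the other. *)
Section Star.
Variable m : nat.

Definition star_adj : rel (option 'I_m) := fun x y => isSome x (+) isSome y.

Lemma star_sym : symmetric star_adj.
Proof. by move=> x y; rewrite /star_adj addbC. Qed.

Lemma star_irr : irreflexive star_adj.
Proof. by move=> x; rewrite /star_adj addbb. Qed.

Lemma star_conn (x y : option 'I_m) : connect star_adj x y.
Proof.
have cN z : connect star_adj None z.
  by case: z => [i|]; [exact: connect1 | exact: connect0].
apply: connect_trans (cN y).
by rewrite (sym_connect_sym star_sym).
Qed.

Definition star_graph := CGraph star_sym star_irr star_conn.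
End Star.

(* In K_{1,m} this singles out [None], except that both vertices of K_{1,1}
   qualify. *)
Definition is_center (G : cgraph) (c : G) : Prop :=
  forall v : G, v != c -> adj c v.

(* The pair (i, a) is the vertex a of the i-th copy of G2. The vertex i of G1
   is identified with the root of that copy, so it is represented by (i, o). *)
Section Cluster.
Variables (G1 G2 : cgraph) (o : G2).

Definition cluster_adj : rel (G1 * G2)%type := fun u v =>
  (u.1 == v.1) && adj u.2 v.2 || [&& u.2 == o, v.2 == o & adj u.1 v.1].

Lemma cluster_sym : symmetric cluster_adj.
Proof.
move=> u v; rewrite /cluster_adj eq_sym (adj_sym u.2) (adj_sym u.1).
by congr (_ || _); rewrite andbCA.
Qed.

Lemma cluster_irr : irreflexive cluster_adj.
Proof. by move=> u; rewrite /cluster_adj !adj_irr !andbF. Qed.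

Lemma cluster_conn (u v : (G1 * G2)%type) : connect cluster_adj u v.
Proof.
have copy i a b : connect cluster_adj (i, a) (i, b).
  apply: (@homo_connect _ _ adj _ (pair i)) (adj_conn a b) => c d cd.
  by rewrite /cluster_adj eqxx cd.
have base i j : connect cluster_adj (i, o) (j, o).
  apply: (@homo_connect _ _ adj _ (pair^~ o)) (adj_conn i j) => c d cd.
  by rewrite /cluster_adj !eqxx cd orbT.
case: u v => [i a] [j b].
exact: connect_trans (copy i a o) (connect_trans (base i j) (copy j o b)).
Qed.

Definition cluster := CGraph cluster_sym cluster_irr cluster_conn.
End Cluster.

Local Open Scope ring_scope.

(* The norm that 'rV[R]_m carries in the libraries is the sup norm. *)
Definition euclidean_norm (R : realType) (m : nat) (v : 'rV[R]_m) : R :=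
  Num.sqrt (\sum_(k < m) v 0 k ^+ 2).

Definition QE_class (R : realType) (G : cgraph) : Prop :=
  exists (m : nat) (psi : G -> 'rV[R]_m),
    forall i j : G, (gdist i j)%:R = euclidean_norm (psi i - psi j) ^+ 2.

(* Main.v *)
Require Import Defs.
From mathcomp Require Import all_boot all_order all_algebra.
From mathcomp Require Import reals ring zify.

(** The cluster of any two graphs of QE class is of QE class ([QE_cluster]);
    the theorem is the case where the second graph is complete or a star.

    A geodesic of [G1{G2}] between different copies of [G2] must leave the first
    copy and enter the second one through their roots, so that
      d((i,a),(j,b)) = d(a,o) + d(i,j) + d(o,b)   for i <> j,
    while d((i,a),(i,b)) = d(a,b) ([gdist_cluster]).  Given embeddings [phi1] of
    [G1] and [phi2] of [G2], give each copy of [G2] its own Euclidean space,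
    orthogonal to the others and to the space of [phi1].  Send [(i,a)] to
    [phi1 i] plus, in the space of copy [k], [phi2 a] if [k = i] and [phi2 o]
    otherwise.  By Pythagoras, squared distances then add up to the formula
    above.

    For the factors, [K_n] embeds as the regular simplex with squared side 1,
    and a star as the origin (its center) together with an orthonormal basis.

    Distances are all computed from one local criterion, [gdist_unique]. *)

Set Implicit Arguments.
Unset Strict Implicit.
Unset Printing Implicit Defensive.

Import Order.TTheory GRing.Theory Num.Theory.

(** * Graph distance *)

(** The distance is defined by simple paths; loop removal makes every walk an
    upper bound. *)
Lemma gdist_le_walk (G : cgraph) (x : G) (p : seq G) :
  path adj x p -> gdist x (last x p) <= size p.
Proof.
case/shortenP=> q pq uq qp; have /andP[_ uq'] := uq.
apply: leq_trans (uniq_leq_size uq' qp).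
rewrite /gdist; case: ex_minnP => m _; apply.
by apply/existsP; exists (in_tuple q); rewrite pq uq eqxx.
Qed.

Lemma gdist_walk (G : cgraph) (x y : G) :
  exists p, [/\ path adj x p, last x p = y & size p = gdist x y].
Proof.
rewrite /gdist; case: ex_minnP => m /existsP[p /and3P[pp _ /eqP pl]] _.
by exists p; rewrite size_tuple.
Qed.

Lemma gdistxx (G : cgraph) (x : G) : gdist x x = 0.
Proof. by apply/eqP; rewrite -leqn0; apply: (@gdist_le_walk G x [::]). Qed.

Lemma gdist_adj (G : cgraph) (x y z : G) :
  adj y z -> gdist x z <= (gdist x y).+1.
Proof.
have [p [pp pl <-]] := gdist_walk x y; move=> yz.
have := @gdist_le_walk G x (rcons p z).
by rewrite rcons_path pp pl yz last_rcons size_rcons; apply.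
Qed.

(** The last but one vertex of a geodesic. *)
Lemma gdist_pred (G : cgraph) (x y : G) : y != x ->
  exists2 z, adj z y & gdist x y = (gdist x z).+1.
Proof.
have [p] := gdist_walk x y; case/lastP: p => [|p t].
  by case=> _ /= ->; rewrite eqxx.
rewrite rcons_path last_rcons size_rcons => -[/andP[pp pt] ty dxy] _.
rewrite -{}ty in dxy *; exists (last x p) => //.
apply/eqP; rewrite eqn_leq gdist_adj // -dxy ltnS.
exact: gdist_le_walk.
Qed.

(** The distance from [x] is the only function that vanishes at [x], grows by at
    most 1 along edges, and drops by 1 along some edge out of any other vertex:
    the second property bounds it by the length of a geodesic, and repeated
    descent gives a walk from [x] of length [f y]. *)
Lemma gdist_unique (G : cgraph) (x : G) (f : G -> nat) :
  f x = 0 ->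
  (forall y z, adj y z -> f z <= (f y).+1) ->
  (forall y, y != x -> exists2 z, adj z y & f y = (f z).+1) ->
  forall y, gdist x y = f y.
Proof.
move=> f0 fS fP y; apply/eqP; rewrite eqn_leq; apply/andP; split.
  have [k] := ubnP (f y); elim: k y => // k IHk y.
  have [->|/fP[z zy ->]] := eqVneq y x; first by rewrite gdistxx.
  rewrite ltnS => zk; apply: leq_trans (gdist_adj x zy) _; exact: IHk.
have [p [pp <- <-]] := gdist_walk x y.
elim/last_ind: p pp => [|p t IHp]; first by rewrite /= f0.
rewrite rcons_path last_rcons size_rcons => /andP[/IHp pp /fS ft].
exact: leq_trans ft _.
Qed.

Lemma gdist_cluster (G1 G2 : cgraph) (o : G2) (u v : cluster G1 o) :
  gdist u v = if u.1 == v.1 then gdist u.2 v.2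
              else gdist u.2 o + gdist u.1 v.1 + gdist o v.2.
Proof.
case: u => i a; move: v; apply: gdist_unique => /=.
- by rewrite eqxx gdistxx.
- case=> j b [k c] /= /orP[/andP[/= /eqP-> bc]|/and3P[/= /eqP-> /eqP-> jk]].
    case: eqP => _; first exact: gdist_adj.
    by rewrite -addnS leq_add2l gdist_adj.
  have dk := gdist_adj (i : G1) jk.
  (* At a root both branches of the formula agree. *)
  have root (l : G1) : (if i == l then gdist a o
                 else gdist a o + gdist i l + gdist o o) = gdist a o + gdist i l.
    by case: eqP => [->|_]; rewrite !gdistxx !addn0.
  by rewrite !root -addnS leq_add2l.
- case=> j b /=; have [<-|ij] := eqVneq i j.
    rewrite xpair_eqE eqxx /= => /gdist_pred[c cb ->].
    by exists (i, c); rewrite /= ?eqxx // /cluster_adj /= eqxx cb.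
  move=> _; have [->|/gdist_pred[c cb ->]] := eqVneq b o; last first.
    exists (j, c); first by rewrite /= /cluster_adj /= eqxx cb.
    by rewrite /= (negPf ij) addnS.
  have [k kj ->] : exists2 k, adj k j & gdist i j = (gdist i k).+1.
    by apply: gdist_pred; rewrite eq_sym.
  exists (k, o); first by rewrite /= /cluster_adj /= !eqxx kj orbT.
  by rewrite /=; case: eqP => [->|_]; rewrite !gdistxx; lia.
Qed.

Lemma gdist_complete (n : nat) (i j : complete_graph n) :
  gdist i j = (i != j).
Proof.
move: j; apply: gdist_unique => [|j k _|j ji]; first by rewrite eqxx.
  by case: (i != k).
by exists i; rewrite /= ?eqxx 1?eq_sym ?ji //= /complete_adj eq_sym.
Qed.

Lemma gdist_star (m : nat) (x y : star_graph m) :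
  gdist x y = if x == y then 0 else if isSome x && isSome y then 2 else 1.
Proof.
move: y; apply: gdist_unique => [|y z|y]; first by rewrite eqxx.
  case: x y z => [i|] [j|] [k|] //=; rewrite /star_adj //= => _.
    by case: ifP.
case: x y => [i|] [j|] //= ji.
- by exists None; rewrite //= eq_sym (negPf ji).
- by exists (Some i); rewrite //= eqxx.
- by exists None.
Qed.

(** * Quadratic embeddings *)

Local Open Scope ring_scope.

(** Coordinates indexed by any finite type: an orthogonal direct sum is then a
    sum type, without arithmetic on dimensions. *)
Lemma QE_classP (R : realType) (G : cgraph) :
  QE_class R G <->
  exists (T : finType) (phi : G -> T -> R),
    forall i j : G, (gdist i j)%:R = \sum_t (phi i t - phi j t) ^+ 2.
Proof.
have norm2 m (v : 'rV[R]_m) : euclidean_norm v ^+ 2 = \sum_k v 0 k ^+ 2.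
  by rewrite sqr_sqrtr // sumr_ge0 // => k _; rewrite sqr_ge0.
split=> [[m [psi psiP]]|[T [phi phiP]]].
  exists 'I_m, (fun x k => psi x 0 k) => i j.
  by rewrite psiP norm2; apply: eq_bigr => k _; rewrite !mxE.
exists #|T|, (fun x => \row_k phi x (enum_val k)) => i j.
rewrite phiP norm2 (reindex (@enum_val T T)) /=.
  by apply: eq_bigr => k _; rewrite !mxE.
exact: onW_bij (enum_val_bij T).
Qed.

Lemma QE_cluster (R : realType) (G1 G2 : cgraph) (o : G2) :
  QE_class R G1 -> QE_class R G2 -> QE_class R (cluster G1 o).
Proof.
move=> /QE_classP[T1 [phi1 phi1P]] /QE_classP[T2 [phi2 phi2P]]; apply/QE_classP.
pose phi (u : cluster G1 o) (t : T1 + G1 * T2) : R :=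
  match t with
  | inl s => phi1 u.1 s
  | inr (k, s) => phi2 (if k == u.1 then u.2 else o) s
  end.
exists (T1 + G1 * T2)%type, phi => -[i a] [j b].
rewrite gdist_cluster big_sumType /= -phi1P.
have -> : \sum_(p : G1 * T2) (phi (i, a) (inr p) - phi (j, b) (inr p)) ^+ 2 =
    \sum_k (gdist (if k == i then a else o) (if k == j then b else o))%:R.
  under [RHS]eq_bigr do rewrite phi2P.
  by rewrite pair_big; apply: eq_bigr => -[k s].
have [<-|ij] := eqVneq i j.
  rewrite gdistxx add0r (bigD1 i) //= eqxx big1 ?addr0 // => k /negPf->.
  by rewrite gdistxx.
have ji : j != i by rewrite eq_sym.
rewrite (bigD1 i) //= (bigD1 j) //= !eqxx (negPf ij) (negPf ji).
rewrite big1 => [|k /andP[/negPf-> /negPf->]]; last by rewrite gdistxx.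
by rewrite !natrD addr0 addrCA addrA.
Qed.

(** Squared distance between two vectors of an orthonormal basis. *)
Lemma sum_sqr_basisB (R : realType) (T : finType) (x y : T) :
  \sum_t ((x == t)%:R - (y == t)%:R) ^+ 2 = (x != y)%:R *+ 2 :> R.
Proof.
have [->|xy] := eqVneq x y; first by rewrite big1 ?mul0rn // => t _; ring.
have yx : y != x by rewrite eq_sym.
rewrite (bigD1 x) //= (bigD1 y) //= !eqxx (negPf xy) (negPf yx).
rewrite big1 => [|t /andP[tx ty]]; first by rewrite /= mulr0n mulr1n; ring.
by rewrite ![_ == t]eq_sym (negPf tx) (negPf ty) subrr expr0n.
Qed.

Lemma QE_complete (R : realType) (n : nat) : QE_class R (complete_graph n).
Proof.
apply/QE_classP; exists 'I_n.
(* Basis vectors are at squared distance 2, hence the scaling. *)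
exists (fun i k => (Num.sqrt 2)^-1 * (i == k)%:R) => i j.
under eq_bigr do rewrite -mulrBr exprMn exprVn sqr_sqrtr ?ler0n //.
rewrite -mulr_sumr sum_sqr_basisB gdist_complete -[X in _ * X]mulr_natl mulKf //.
by rewrite pnatr_eq0.
Qed.

Lemma QE_star (R : realType) (m : nat) : QE_class R (star_graph m).
Proof.
apply/QE_classP; exists 'I_m, (fun x k => (x == Some k)%:R) => x y.
have leaf (i : 'I_m) : \sum_k ((Some i == Some k)%:R : R) ^+ 2 = 1.
  rewrite (bigD1 i) //= eqxx expr1n big1 ?addr0 // => k ki.
  by rewrite (inj_eq Some_inj) eq_sym (negPf ki) expr0n.
rewrite gdist_star; case: x y => [i|] [j|] /=.
- under eq_bigr do rewrite !(inj_eq Some_inj).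
  rewrite sum_sqr_basisB (inj_eq Some_inj).
  by case: eqP; rewrite ?mul0rn.
- by under eq_bigr do rewrite subr0; rewrite leaf.
- by under eq_bigr do rewrite sub0r sqrrN; rewrite leaf.
- by rewrite big1 // => k _; rewrite subrr expr0n.
Qed.

Local Close Scope ring_scope.

Theorem corollary4p5 (R : realType) (n : nat) (hn : 2 <= n)
    (G : cgraph) (hG : 2 <= #|G|) :
  QE_class R G ->
  (forall r : complete_graph n, QE_class R (cluster G r)) /\
  (forall c : star_graph n.-1, is_center c -> QE_class R (cluster G c)).
Proof.
move=> QG; split=> [r|c _]; apply: QE_cluster => //.
  exact: QE_complete.
exact: QE_star.
Qed.
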